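(* Let $\sigma>0$. If $f=\sum_{n\in\mathbb N_0^d}a_n(f)l_n\in\mathcal G_{\flat_\sigma}(\mathbb R^d_+)$, then $f\circ v\in\mathcal H_{\flat_\sigma,even}(\mathbb R^d)$ and $f\circ v=\sum_{n\in\mathbb N_0^d}b_{2n}h_{2n}$, where $\{b_{2n}\}_{n\in\mathbb N_0^d}\in\ell_{\flat_\sigma}(\mathbb N_0^d)$ is given by $$b_{2n}=\frac{(-1)^{|n|}\pi^{d/4}\sqrt{(2n)!}}{2^{|n|}n!}\sum_{k\in\mathbb N_0^d}a_{k+n}(f)\binom{k-\mathbf{1/2}}{k},\quad n\in\mathbb N_0^d.$$
   Context: $\mathbb R^d_+=(0,\infty)^d$; $v(x)=(x_1^2,\dots,x_d^2)$ for $x\in\mathbb R^d$. Multi-indices: $|n|=\sum n_j$, $n!=\prod n_j!$, $2n=(2n_1,\dots,2n_d)$, $\mathbf{1/2}=(1/2,\dots,1/2)$, $\binom{\gamma}{m}=\prod_j\frac{\gamma_j(\gamma_j-1)\cdots(\gamma_j-m_j+1)}{m_j!}$. Laguerre functions $l_n(x)=\prod_jL_{n_j}(x_j)e^{-x_j/2}$ on $[0,\infty)^d$ with $L_m(t)=\frac{e^t}{m!}\frac{d^m}{dt^m}(e^{-t}t^m)$; Hermite functions $h_n(x)=\prod_j(2^{n_j}n_j!\sqrt\pi)^{-1/2}e^{-x_j^2/2}H_{n_j}(x_j)$, $H_m(t)=(-1)^me^{t^2}\frac{d^m}{dt^m}e^{-t^2}$. For $\tau>0$, $\ell_{\flat_\tau}(\mathbb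 N_0^d)$ is the set of complex sequences $\{a_n\}$ such that $\sup_n|a_n|h^{|n|}n!^{1/(2\tau)}<\infty$ for some $h>0$. $\mathcal G_{\flat_\sigma}(\mathbb R^d_+)$ is the space of functions $f=\sum_na_nl_n$ (absolutely convergent series) with $\{a_n\}\in\ell_{\flat_{\sigma/2}}(\mathbb N_0^d)$, and $a_n(f)=a_n$. $\mathcal H_{\flat_\sigma}(\mathbb R^d)$ is the space of $\sum_na_nh_n$ with $\{a_n\}\in\ell_{\flat_\sigma}(\mathbb N_0^d)$, and $\mathcal H_{\flat_\sigma,even}(\mathbb R^d)$ its subspace of functions invariant under changing the sign of any single coordinate. The notation $\{b_{2n}\}_n\in\ell_{\flat_\sigma}(\mathbb N_0^d)$ means that the sequence equal to $b_k$ at $k=2n$ and $0$ elsewhere belongs to $\ell_{\flat_\sigma}(\mathbb N_0^d)$. *)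

(* Defs.v *)
From Stdlib Require Import Reals.
From Coquelicot Require Import Coquelicot.
From mathcomp Require Import ssreflect ssrfun ssrbool eqtype ssrnat seq fintype finfun bigop.

Set Implicit Arguments.
Unset Strict Implicit.
Unset Printing Implicit Defensive.

Definition mi (d : nat) := 'I_d -> nat.
Definition pt (d : nat) := 'I_d -> R.

Definition mabs {d} (n : mi d) : nat := \sum_(j < d) n j.
Definition mfact {d} (n : mi d) : nat := \prod_(j < d) (n j)`!.
Definition mdouble {d} (n : mi d) : mi d := fun j => (2 * n j)%N.
Definition madd {d} (k n : mi d) : mi d := fun j => (k j + n j)%N.

Definition gbinom (g : R) (m : nat) : R :=
  (\big[Rmult/1%R]_(i < m) (g - INR i)%R / INR (m`!))%R.
Definition mbinom_half {d} (k : mi d) : R :=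
  \big[Rmult/1%R]_(j < d) gbinom (INR (k j) - /2)%R (k j).

Definition vsq {d} (x : pt d) : pt d := fun j => (x j ^ 2)%R.

(* Laguerre polynomial via Rodrigues: L_m(t) = e^t/m! d^m/dt^m (e^{-t} t^m) *)
Definition laguerre (m : nat) (t : R) : R :=
  (/ INR (m`!) * exp t * Derive_n (fun s => exp (- s) * s ^ m) m t)%R.
Definition lfun {d} (n : mi d) (x : pt d) : R :=
  \big[Rmult/1%R]_(j < d) (laguerre (n j) (x j) * exp (- (x j) / 2))%R.

Definition hermite (m : nat) (t : R) : R :=
  ((-1) ^ m * exp (t ^ 2) * Derive_n (fun s => exp (- s ^ 2)) m t)%R.
Definition hfun {d} (n : mi d) (x : pt d) : R :=
  \big[Rmult/1%R]_(j < d)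
    (/ sqrt (2 ^ (n j) * INR ((n j)`!) * sqrt PI) * exp (- (x j) ^ 2 / 2)
       * hermite (n j) (x j))%R.

Definition ell_flat {d} (tau : R) (a : mi d -> C) : Prop :=
  exists h : R, (0 < h)%R /\ exists M : R, forall n : mi d,
    (Cmod (a n) * h ^ (mabs n) * Rpower (INR (mfact n)) (/ (2 * tau)))%R <= M.

Definition boxsum {d} (a : mi d -> C) (N : nat) : C :=
  \big[Cplus/RtoC 0]_(m : {ffun 'I_d -> 'I_N.+1}) a (fun j => nat_of_ord (m j)).

Definition abs_summable {d} (a : mi d -> C) : Prop :=
  exists M : R, forall N : nat,
    (\big[Rplus/0%R]_(m : {ffun 'I_d -> 'I_N.+1}) Cmod (a (fun j => nat_of_ord (m j))))
      <= M.
Definition has_msum {d} (a : mi d -> C) (s : C) : Prop :=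
  abs_summable a /\ filterlim (boxsum a) eventually (locally s).

(* [0,oo)^d, the closure of R^d_+ where the Laguerre functions live *)
Definition nonneg_pt {d} (x : pt d) : Prop := forall j, (0 <= x j)%R.

Definition G_flat {d} (sigma : R) (f : pt d -> C) : Prop :=
  exists a : mi d -> C, ell_flat (sigma / 2) a /\
    forall x, nonneg_pt x -> has_msum (fun n => Cmult (a n) (RtoC (lfun n x))) (f x).

Definition H_flat {d} (sigma : R) (g : pt d -> C) : Prop :=
  exists c : mi d -> C, ell_flat sigma c /\
    forall x, has_msum (fun n => Cmult (c n) (RtoC (hfun n x))) (g x).
Definition flip {d} (j : 'I_d) (x : pt d) : pt d :=
  fun i => if i == j then (- x i)%R else x i.
Definition H_flat_even {d} (sigma : R) (g : pt d -> C) : Prop :=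
  H_flat sigma g /\ forall (j : 'I_d) (x : pt d), g (flip j x) = g x.

Definition even_ext {d} (b2 : mi d -> C) : mi d -> C :=
  fun m => if [forall j : 'I_d, ~~ odd (m j)] then b2 (fun j => (m j)./2) else RtoC 0.

Definition bcoef {d} (n : mi d) : R :=
  ((-1) ^ (mabs n) * Rpower PI (INR d / 4) * sqrt (INR (mfact (mdouble n)))
     / (2 ^ (mabs n) * INR (mfact n)))%R.

(* Main.v *)
From HB Require Import structures.
Require Import Defs.
From Stdlib Require Import Reals Lra FunctionalExtensionality.
From Coquelicot Require Import Coquelicot.
From mathcomp Require Import ssreflect ssrfun ssrbool eqtype ssrnat seq fintype finfun bigop binomial.

Set Implicit Arguments.
Unset Strict Implicit.
Unset Printing Implicit Defensive.
Local Open Scope R_scope.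

(* In one variable, L_n(x^2) = sum_(i <= n) binom(n-i-1/2, n-i) N_i(x) with
   N_i = (-1)^i H_(2i) / (4^i i!): both sides satisfy F_(n+1)' = F_n' - 2 x F_n and F_n(0) = 1.
   Taking products over the coordinates, f o v becomes a double series over (i, k) with terms
   a_(i+k) binom(k-1/2, k) N_i(x) exp (-|x|^2/2), and bcoef turns the last two factors into
   h_(2i).  Since (i+k)! >= i! k! and N_i grows at most geometrically, the terms are dominated
   by a product u_i w_k of two summable families.  The partial sums of the two series are the
   sums over the triangle {i + k <= N} and over the square {i, k <= N}; the pairs that
   differ lie outside the square {i, k <= N/2}, so the difference tends to 0. *)

(** * Iterated sums and products over R and C, factorials and derivatives *)

HB.instance Definition _ := Monoid.isComLaw.Build R 0 Rplus
  (fun x y z => esym (Rplus_assoc x y z)) Rplus_comm Rplus_0_l.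
HB.instance Definition _ := Monoid.isComLaw.Build R 1 Rmult
  (fun x y z => esym (Rmult_assoc x y z)) Rmult_comm Rmult_1_l.
HB.instance Definition _ := Monoid.isMulLaw.Build R 0 Rmult Rmult_0_l Rmult_0_r.
HB.instance Definition _ := Monoid.isAddLaw.Build R Rmult Rplus
  Rmult_plus_distr_r Rmult_plus_distr_l.
HB.instance Definition _ := Monoid.isComLaw.Build C (RtoC 0) Cplus
  Cplus_assoc Cplus_comm Cplus_0_l.
HB.instance Definition _ := Monoid.isLaw.Build C (RtoC 1) Cmult
  Cmult_assoc Cmult_1_l Cmult_1_r.
HB.instance Definition _ := Monoid.isMulLaw.Build C (RtoC 0) Cmult Cmult_0_l Cmult_0_r.
HB.instance Definition _ := Monoid.isAddLaw.Build C Cmult Cplus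
  Cmult_plus_distr_r Cmult_plus_distr_l.

Lemma INR_fact_gt0 n : 0 < INR n`!.
Proof. by apply/lt_0_INR/ltP; rewrite fact_gt0. Qed.

Lemma INR_factS n : INR n.+1`! = (INR n + 1) * INR n`!.
Proof. by rewrite factS mult_INR S_INR. Qed.

Lemma is_derive_sum n (F G : nat -> R -> R) (x : R) :
  (forall i, is_derive (F i) x (G i x)) ->
  is_derive (fun t => \big[Rplus/0]_(i < n) F i t) x (\big[Rplus/0]_(i < n) G i x).
Proof.
move=> H; elim: n => [|n IH].
  rewrite big_ord0; apply: (is_derive_ext (fun=> 0)) => [t|]; first by rewrite big_ord0.
  exact: is_derive_const.
rewrite big_ord_recr /=.
apply: (is_derive_ext (fun t => \big[Rplus/0]_(i < n) F i t + F n t)) => [t|].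
  by rewrite big_ord_recr.
exact: (is_derive_plus _ _ _ _ _ IH (H n)).
Qed.

Lemma eq_of_derive (f g df : R -> R) :
  (forall x, is_derive f x (df x)) -> (forall x, is_derive g x (df x)) ->
  f 0 = g 0 -> forall x, f x = g x.
Proof.
move=> Hf Hg H0 x.
have Hh y : is_derive (fun t => minus (f t) (g t)) y zero.
  by rewrite -(minus_eq_zero (df y)); apply: is_derive_minus.
have E : f x - g x = f 0 - g 0.
  have [Hx|[->//|Hx]] := Rtotal_order x 0.
    exact: (eq_is_derive _ x 0 (fun t _ => Hh t) Hx).
  exact/esym/(eq_is_derive _ 0 x (fun t _ => Hh t) Hx).
lra.
Qed.

(** * Laguerre and Hermite polynomials *)

(* [dnexp k m] is the k-th derivative of [exp (- t) * t ^ m]; the recursion comes from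
   (exp (- t) t^(m+1))' = (m+1) exp (- t) t^m - exp (- t) t^(m+1). *)
Fixpoint dnexp (k m : nat) (t : R) : R :=
  match k, m with
  | 0%N, _ => exp (- t) * t ^ m
  | k'.+1, 0%N => - dnexp k' 0 t
  | k'.+1, m'.+1 => (INR m' + 1) * dnexp k' m' t - dnexp k' m'.+1 t
  end.

Lemma dnexpSS k m t : dnexp k.+1 m.+1 t = (INR m + 1) * dnexp k m t - dnexp k m.+1 t.
Proof. by []. Qed.

Lemma is_derive_dnexp k m t : is_derive (dnexp k m) t (dnexp k.+1 m t).
Proof.
elim: k m => [|k IH] [|m].
- rewrite /=; auto_derive => //; ring.
- rewrite /dnexp; auto_derive => //.
  by case: m => [|m]; rewrite ?S_INR /=; ring.
- exact: (is_derive_opp (dnexp k 0) t _ (IH 0%N)).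
- apply: (is_derive_minus (fun t => (INR m + 1) * dnexp k m t) (dnexp k m.+1) t _ _ _ (IH m.+1)).
  exact: (is_derive_scal (dnexp k m) t _ _ (IH m)).
Qed.

Lemma Derive_n_dnexp k m t : Derive_n (fun s => exp (- s) * s ^ m) k t = dnexp k m t.
Proof.
elim: k t => [//|k IH] t.
by rewrite /= (Derive_ext _ _ _ IH); apply: is_derive_unique; apply: is_derive_dnexp.
Qed.

(** [t ^ m] vanishes to order m at the origin, and fewer than m derivatives leave a zero there. *)
Lemma dnexp_lt0 k m : (k < m)%N -> dnexp k m 0 = 0.
Proof.
elim: k m => [|k IH] [|m] //= Hkm; first by rewrite Rmult_0_l Rmult_0_r.
have Hm : (k < m)%N by []. rewrite (IH m Hm) (IH m.+1 (ltnW Hm)). ring.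
Qed.

(** At the origin each step of the recursion keeps only the factor m + 1; its other term vanishes by
    [dnexp_lt0]. *)
Lemma dnexp_fact k : dnexp k k 0 = INR k`!.
Proof.
elim: k => [|k IH] /=; first by rewrite Ropp_0 exp_0; ring.
by rewrite IH dnexp_lt0 // INR_factS; ring.
Qed.

Lemma laguerreE n t : laguerre n t = / INR n`! * exp t * dnexp n n t.
Proof. by rewrite /laguerre Derive_n_dnexp. Qed.

Lemma laguerre_at0 n : laguerre n 0 = 1.
Proof.
by rewrite laguerreE exp_0 dnexp_fact; field; apply/Rgt_not_eq/INR_fact_gt0.
Qed.

Lemma laguerre0 t : laguerre 0 t = 1.
Proof.
by rewrite laguerreE /= Rinv_1 !Rmult_1_l Rmult_1_r -exp_plus Rplus_opp_r exp_0.
Qed.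

Lemma is_derive_laguerre n t :
  is_derive (laguerre n) t (/ INR n`! * exp t * (dnexp n n t + dnexp n.+1 n t)).
Proof.
apply: (is_derive_ext (fun t => / INR n`! * exp t * dnexp n n t)) => [s|].
  by rewrite laguerreE.
evar_last.
  apply: (is_derive_mult (fun t => / INR n`! * exp t) (dnexp n n)).
  - by apply: is_derive_scal; apply: is_derive_exp.
  - exact: is_derive_dnexp.
  - exact: Rmult_comm.
rewrite /plus /mult /=; ring.
Qed.

(** The recursion of [dnexp] collapses the derivative of L_(n+1) to [exp t * dnexp n.+1 n t] over
    n!. This is one of the two terms in the derivative of L_n, and the other term is L_n itself. *)
Lemma Derive_laguerreS n t :
  Derive (laguerre n.+1) t = Derive (laguerre n) t - laguerre n t.
Proof.
rewrite (is_derive_unique _ _ _ (is_derive_laguerre n t)).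
rewrite (is_derive_unique _ _ _ (is_derive_laguerre n.+1 t)).
rewrite laguerreE INR_factS (dnexpSS n.+1 n).
have := INR_fact_gt0 n; have := pos_INR n => ? ?.
by field; split; lra.
Qed.

(** The pair (H_n, H_(n+1)): carrying both makes the three-term recurrence structural. *)
Fixpoint hermite2 (n : nat) (x : R) : R * R :=
  if n is n'.+1 then
    let p := hermite2 n' x in (p.2, 2 * x * p.2 - 2 * (INR n' + 1) * p.1)
  else (1, 2 * x).

Definition hrec n x := (hermite2 n x).1.

Lemma hrecSS n x : hrec n.+2 x = 2 * x * hrec n.+1 x - 2 * (INR n + 1) * hrec n x.
Proof. by []. Qed.

Lemma is_derive_hrec n x : is_derive (hrec n) x (2 * INR n * hrec n.-1 x).
Proof.
(* The recurrence reaches back two indices, so two consecutive derivatives are established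
   together. *)
suff: is_derive (hrec n) x (2 * INR n * hrec n.-1 x) /\
      is_derive (hrec n.+1) x (2 * INR n.+1 * hrec n x) by case.
elim: n => [|n [IH1 IH2]].
  split.
    by rewrite Rmult_0_r Rmult_0_l; apply: is_derive_const.
  by rewrite /hrec /=; auto_derive => //; ring.
split=> //.
apply: (is_derive_ext (fun x => 2 * x * hrec n.+1 x - 2 * (INR n + 1) * hrec n x)) => //.
evar_last.
  apply: (is_derive_minus (fun x => 2 * x * hrec n.+1 x) (fun x => 2 * (INR n + 1) * hrec n x)).
    apply: (is_derive_mult (fun x => 2 * x) (hrec n.+1)) IH2 _; last exact: Rmult_comm.
    by apply: (is_derive_scal (fun x => x)); apply: is_derive_id.
  exact: (is_derive_scal (hrec n) _ _ _ IH1).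
rewrite !S_INR /minus /plus /mult /opp /one /=.
case: n {IH1 IH2} => [|n]; first by rewrite /hrec /=; ring.
by rewrite hrecSS S_INR /=; ring.
Qed.

(** Differentiating H_n exp (-x^2) produces the factor H_n' - 2 x H_n, which equals -H_(n+1) because
    H_n' = 2 n H_(n-1). *)
Lemma Derive_n_gauss n x :
  Derive_n (fun s => exp (- s ^ 2)) n x = (-1) ^ n * hrec n x * exp (- x ^ 2).
Proof.
elim: n x => [|n IH] x; first by rewrite /= /hrec /=; ring.
rewrite /= (Derive_ext _ _ _ IH); apply: is_derive_unique.
evar_last.
  apply: (is_derive_mult (fun x => (-1) ^ n * hrec n x) (fun x => exp (- x ^ 2))).
  - by apply: is_derive_scal; apply: is_derive_hrec.
  - by auto_derive=> //.
  - exact: Rmult_comm.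
rewrite /plus /mult /=.
case: n {IH} => [|n]; first by rewrite /hrec /=; ring.
by rewrite hrecSS S_INR /=; ring.
Qed.

Lemma hermiteE n x : hermite n x = hrec n x.
Proof.
rewrite /hermite Derive_n_gauss.
have E : exp (x ^ 2) * exp (- x ^ 2) = 1 by rewrite -exp_plus Rplus_opp_r exp_0.
have S1 : (-1) ^ n * (-1) ^ n = 1 by rewrite -Rpow_mult_distr -[RHS](pow1 n); congr (_ ^ _); ring.
transitivity (((-1) ^ n * (-1) ^ n) * hrec n x * (exp (x ^ 2) * exp (- x ^ 2))); first ring.
by rewrite E S1; ring.
Qed.

Lemma Rsum_rev n (F : nat -> nat -> R) :
  \big[Rplus/0]_(i < n.+1) F i (n - i)%N = \big[Rplus/0]_(i < n.+1) F (n - i)%N i.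
Proof.
rewrite (reindex_inj rev_ord_inj) /=; apply: eq_bigr => i _.
by rewrite subSS subKn // -ltnS.
Qed.

(** * Laguerre polynomials at a square *)

(* [cbin k] is (1/2)_k / k! = binom(2k, k) / 4^k. *)
Definition cbin (k : nat) : R := gbinom (INR k - / 2) k.

Lemma cbin0 : cbin 0 = 1.
Proof. by rewrite /cbin /gbinom big_ord0 fact0 /=; field. Qed.

Lemma cbinS k : (INR k + 1) * cbin k.+1 = (INR k + / 2) * cbin k.
Proof.
(* The factor i = 0 is k + 1/2; shifting the remaining ones by one gives the product for k. *)
rewrite /cbin /gbinom big_ord_recl INR_factS S_INR.
rewrite (eq_bigr (fun i : 'I_k => INR k - / 2 - INR i)); last first.
  by move=> i _; rewrite lift0 S_INR; ring.
have := INR_fact_gt0 k; have := pos_INR k => ? ? /=.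
by field; lra.
Qed.

Lemma cbin_bounds k : 0 <= cbin k <= 1.
Proof.
elim: k => [|k IH]; first by rewrite cbin0; lra.
have := cbinS k; have := pos_INR k => ? ?.
by split; apply: (Rmult_le_reg_l (INR k + 1)); nra.
Qed.

(** Coefficient form of the fact that (1 - t)^(-1/2) squares to 1 / (1 - t). Symmetry gives 2 D_n =
    n E_n, and [cbinS] gives D_(n+1) = D_n + E_n / 2; together they force E_(n+1) = E_n. *)
Lemma cbin_conv n : \big[Rplus/0]_(i < n.+1) (cbin (n - i) * cbin i) = 1.
Proof.
pose D n := \big[Rplus/0]_(i < n.+1) (INR i * (cbin (n - i)%N * cbin i)).
pose E n := \big[Rplus/0]_(i < n.+1) (cbin (n - i)%N * cbin i).
have sym m : 2 * D m = INR m * E m.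
  have E' : D m = \big[Rplus/0]_(i < m.+1) (INR (m - i) * (cbin (m - i)%N * cbin i)).
    apply: etrans (esym (Rsum_rev m (fun i j => INR j * (cbin i * cbin j)))) _.
    by apply: eq_bigr => i _; ring.
  have -> : 2 * D m = D m + D m by ring.
  rewrite {2}E' {1}/D -big_split big_distrr; apply: eq_bigr => i _ /=.
  by rewrite minus_INR; [ring | apply/leP; rewrite -ltnS].
have step m : D m.+1 = D m + / 2 * E m.
  rewrite [LHS]big_ord_recl Rmult_0_l Rplus_0_l big_distrr -big_split.
  apply: eq_bigr => i _; rewrite lift0 subSS S_INR.
  transitivity (cbin (m - i)%N * ((INR i + 1) * cbin i.+1)).
    by rewrite /=; ring.
  by rewrite cbinS /=; ring.
rewrite -/(E n); elim: n => [|n IH]; first by rewrite /E big_ord1 /= cbin0; ring.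
have := sym n.+1; have := sym n; rewrite step IH S_INR; have := pos_INR n => ? ? ?.
by apply: (Rmult_eq_reg_l (INR n + 1)); lra.
Qed.

(* These are the polynomials L_n^(-1/2)(x^2). *)
Definition ehermite (n : nat) (x : R) : R :=
  (-1) ^ n * hermite (2 * n) x / (4 ^ n * INR n`!).

Lemma hermiteSS n x : hermite n.+2 x = 2 * x * hermite n.+1 x - 2 * (INR n + 1) * hermite n x.
Proof. by rewrite !hermiteE hrecSS. Qed.

Lemma pow4fact_gt0 n : 0 < 4 ^ n * INR n`!.
Proof. by apply: Rmult_lt_0_compat; [apply: pow_lt; lra | exact: INR_fact_gt0]. Qed.

Lemma ehermite0 x : ehermite 0 x = 1.
Proof. by rewrite /ehermite hermiteE /hrec muln0 fact0 /=; field. Qed.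

(** At the origin the Hermite recurrence loses its first term, and what remains is the recursion
    [cbinS]. *)
Lemma ehermite_at0 n : ehermite n 0 = cbin n.
Proof.
elim: n => [|n IH]; first by rewrite ehermite0 cbin0.
have := cbinS n; rewrite -{}IH; have := pow4fact_gt0 n; have := pos_INR n => ? ? H.
apply: (Rmult_eq_reg_l (INR n + 1)); last lra.
have Hf := INR_fact_gt0 n; have H4 : 4 ^ n <> 0 by apply: pow_nonzero; lra.
rewrite H /ehermite mulnS hermiteSS INR_factS mult_INR /=.
by field; lra.
Qed.

(** Obtained from H_m' = 2 m H_(m-1) with m = 2n. At n = 0, where [.-1] truncates, the factor
    [INR n] is zero. *)
Definition dehermite (n : nat) (x : R) : R :=
  (-1) ^ n * (4 * INR n * hermite (2 * n).-1 x) / (4 ^ n * INR n`!).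

Lemma is_derive_ehermite n x : is_derive (ehermite n) x (dehermite n x).
Proof.
have E t : (-1) ^ n / (4 ^ n * INR n`!) * hrec (2 * n) t = ehermite n t.
  by rewrite /ehermite hermiteE /Rdiv; ring.
apply: (is_derive_ext _ _ _ _ E).
evar_last; first by apply: is_derive_scal; apply: is_derive_hrec.
by rewrite /dehermite hermiteE mult_INR /=; rewrite /Rdiv; ring.
Qed.

(** Once 4 (n + 1) is cancelled, the left side is a multiple of H_(2n+1), which the three-term
    recurrence splits. The case n = 0 is apart because H_(2n-1) does not exist there. *)
Lemma dehermiteS n x : dehermite n.+1 x = dehermite n x - 2 * x * ehermite n x.
Proof.
have H4 m : 4 ^ m <> 0 by apply: pow_nonzero; lra.
case: n => [|n]; first by rewrite /dehermite /ehermite !hermiteE /hrec /=; field.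
have E1 : (2 * n.+2).-1 = (2 * n).+3 by rewrite !mulnS.
have E2 : (2 * n.+1)%N = (2 * n).+2 by rewrite mulnS.
have E3 : (2 * n.+1).-1 = (2 * n).+1 by rewrite mulnS.
rewrite /dehermite /ehermite E1 E3 E2 (hermiteSS (2 * n).+1).
have := INR_fact_gt0 n; have := pos_INR n => ? ?.
rewrite !INR_factS !S_INR mult_INR -[INR 2]/2 [(-1) ^ n.+2]/= [(-1) ^ n.+1]/= [4 ^ n.+2]/= [4 ^ n.+1]/=.
by field; have := H4 n; lra.
Qed.

Lemma laguerre_sq n x :
  laguerre n (x ^ 2) = \big[Rplus/0]_(i < n.+1) (cbin (n - i) * ehermite i x).
Proof.
pose F n x := \big[Rplus/0]_(i < n.+1) (cbin (n - i) * ehermite i x).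
pose dF n x := \big[Rplus/0]_(i < n.+1) (cbin (n - i) * dehermite i x).
have FE m y : is_derive (F m) y (dF m y).
  apply: (@is_derive_sum m.+1 (fun i x => cbin (m - i) * ehermite i x)
                        (fun i x => cbin (m - i) * dehermite i x)) => i.
  by apply: is_derive_scal; apply: is_derive_ehermite.
have dFS m y : dF m.+1 y = dF m y - 2 * y * F m y.
  (* The term i = 0 is the derivative of a constant; without it, a shift by one lines the sum up
     with the coefficients for m. *)
  rewrite [LHS]big_ord_recl {1}/dehermite [INR ord0]/= !(Rmult_0_r, Rmult_0_l, Rdiv_0_l) Rplus_0_l.
  have -> : dF m y - 2 * y * F m y = dF m y + (- (2 * y)) * F m y by ring.
  rewrite big_distrr -big_split; apply: eq_bigr => i _.
  by rewrite lift0 subSS dehermiteS /=; ring.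
rewrite -/(F n x); elim: n x => [|n IH] x.
  by rewrite /F big_ord1 cbin0 ehermite0 laguerre0; ring.
have dL m y : is_derive (fun t => laguerre m (t ^ 2)) y (2 * y * Derive (laguerre m) (y ^ 2)).
  evar_last.
    apply: (is_derive_comp (laguerre m) (fun t => t ^ 2)).
      by apply: Derive_correct; eexists; apply: is_derive_laguerre.
    by auto_derive.
  by rewrite /scal /= /mult /=; ring.
apply: (@eq_of_derive (fun t => laguerre n.+1 (t ^ 2)) (F n.+1) (dF n.+1)) => [y|y|].
- rewrite dFS -IH; evar_last; first exact: dL.
  rewrite Derive_laguerreS Rmult_minus_distr_l; congr (_ - _).
  (* Both sides are derivatives of functions that agree everywhere by induction. *)
  rewrite -(is_derive_unique _ _ _ (dL n y)) -(is_derive_unique _ _ _ (FE n y)).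
  exact: Derive_ext.
- exact: FE.
- have -> : 0 ^ 2 = 0 by ring.
  (* Both sides are 1 at the origin, the right one by the convolution identity. *)
  rewrite laguerre_at0 -(cbin_conv n.+1).
  by apply: eq_bigr => i _; rewrite ehermite_at0.
Qed.

(** Geometric growth at a fixed point is enough, since the weights below decay factorially. The
    induction bounds H_(2n) and H_(2n+1) jointly by A K^n 4^n n!. *)
Lemma ehermite_growth n x :
  Rabs (ehermite n x) <= (1 + 2 * Rabs x) * ((1 + 2 * Rabs x) ^ 2) ^ n.
Proof.
pose y := Rabs x; have y0 : 0 <= y := Rabs_pos x.
rewrite -/y; set A := 1 + 2 * y; pose K := A ^ 2; rewrite -/K.
have EK : K = 1 + 4 * y + 4 * y * y by rewrite /K /A; ring.
suff H : Rabs (hrec (2 * n) x) <= A * K ^ n * (4 ^ n * INR n`!) /\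
           Rabs (hrec (2 * n).+1 x) <= A * K ^ n * (4 ^ n * INR n`!).
  have P := pow4fact_gt0 n.
  rewrite /ehermite hermiteE Rabs_div ?Rabs_mult ?pow_1_abs ?Rmult_1_l; last lra.
  rewrite (Rabs_pos_eq (4 ^ n)); last by apply: pow_le; lra.
  rewrite (Rabs_pos_eq (INR _)); last exact: pos_INR.
  apply: (Rmult_le_reg_r (4 ^ n * INR n`!)) => //.
  by rewrite /Rdiv Rmult_assoc Rinv_l ?Rmult_1_r; [case: H | lra].
elim: n => [|n [IH1 IH2]].
  rewrite /hrec /= Rabs_R1 Rabs_mult (Rabs_pos_eq 2) -/y /A; lra.
rewrite mulnS.
set B := A * K ^ n * (4 ^ n * INR n`!) in IH1 IH2.
have -> : A * K ^ n.+1 * (4 ^ n.+1 * INR n.+1`!) = K * (4 * (INR n + 1)) * B.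
  by rewrite /B INR_factS /=; ring.
have n0 := pos_INR n; have B0 : 0 <= B by apply: Rle_trans (Rabs_pos _) IH1.
(* The sharper factor 1 + y in place of K leaves room for the next odd polynomial: 2 y (1 + y) + 1
   <= K. *)
have H1 : Rabs (hrec (2 * n).+2 x) <= (1 + y) * (4 * (INR n + 1)) * B.
  rewrite hrecSS mult_INR /=; apply: Rle_trans (Rabs_triang _ _) _.
  rewrite Rabs_Ropp !Rabs_mult -/y (Rabs_pos_eq 2); last lra.
  rewrite (Rabs_pos_eq (_ + 1)); last lra.
  have ? := Rmult_le_compat_l y _ _ y0 IH2.
  have ? := Rmult_le_compat_l (INR n) _ _ n0 IH1.
  have ? := Rmult_le_pos _ _ n0 B0.
  have ? := Rmult_le_pos _ _ y0 B0.
  have ? := Rmult_le_pos _ _ y0 (Rmult_le_pos _ _ n0 B0).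
  lra.
have ? := Rmult_le_pos _ _ n0 B0.
have ? := Rmult_le_pos _ _ y0 B0.
have ? := Rmult_le_pos _ _ y0 (Rmult_le_pos _ _ n0 B0).
have ? := Rmult_le_pos _ _ y0 (Rmult_le_pos _ _ y0 B0).
have ? := Rmult_le_pos _ _ y0 (Rmult_le_pos _ _ y0 (Rmult_le_pos _ _ n0 B0)).
split.
  by apply: Rle_trans H1 _; rewrite EK; lra.
rewrite hrecSS; apply: Rle_trans (Rabs_triang _ _) _.
rewrite Rabs_Ropp !Rabs_mult -/y (Rabs_pos_eq 2); last lra.
rewrite (Rabs_pos_eq (_ + 1)); last by have := pos_INR (2 * n).+1; lra.
have -> : INR (2 * n).+1 = 2 * INR n + 1 by rewrite S_INR mult_INR.
have ? := Rmult_le_compat_l y _ _ y0 H1.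
have ? := Rmult_le_compat_l (INR n) _ _ n0 IH2.
by rewrite EK; lra.
Qed.

(** * Box sums *)

(** On the selected indices [phi] and [psi] are inverse in every coordinate, hence on the boxes.
    [inord] only packs values into ordinals; its default is never reached on selected indices. *)
Lemma box_reindex (T : Type) (idx : T) (op : Monoid.com_law idx) d A B
    (P Q : 'I_d -> pred nat) (phi psi : 'I_d -> nat -> nat) (F : mi d -> T) :
  (forall j m, (m <= B)%N -> Q j m ->
     [/\ (phi j m <= A)%N, P j (phi j m) & psi j (phi j m) = m]) ->
  (forall j m, (m <= A)%N -> P j m ->
     [/\ (psi j m <= B)%N, Q j (psi j m) & phi j (psi j m) = m]) ->
  \big[op/idx]_(m : {ffun 'I_d -> 'I_A.+1} | [forall j, P j (m j)]) F (fun j => m j)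
  = \big[op/idx]_(m : {ffun 'I_d -> 'I_B.+1} | [forall j, Q j (m j)]) F (fun j => phi j (m j)).
Proof.
move=> HQ HP.
pose h (m : {ffun 'I_d -> 'I_B.+1}) : {ffun 'I_d -> 'I_A.+1} := [ffun j => inord (phi j (m j))].
pose h' (m : {ffun 'I_d -> 'I_A.+1}) : {ffun 'I_d -> 'I_B.+1} := [ffun j => inord (psi j (m j))].
have leB (m : {ffun 'I_d -> 'I_B.+1}) j : (m j <= B)%N by rewrite -ltnS.
have leA (m : {ffun 'I_d -> 'I_A.+1}) j : (m j <= A)%N by rewrite -ltnS.
rewrite (reindex_onto h h') => [|m /forallP Pm]; last first.
  apply/ffunP => j; apply: val_inj; rewrite !ffunE /=.
  have [a b c] := HP j _ (leA m j) (Pm j).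
  by rewrite !inordK ?c // ltnS ?leA.
have hK (m : {ffun 'I_d -> 'I_B.+1}) j : Q j (m j) -> h m j = phi j (m j) :> nat.
  move=> Qm; have [a b c] := HQ j _ (leB m j) Qm.
  by rewrite ffunE inordK.
(* [reindex_onto] adds the condition [h' (h m) = m] to the one from [P]; jointly they amount to
   [Q]. *)
apply: eq_big => [m|m /andP[/forallP Pm /eqP E]].
  apply/andP/forallP => [[/forallP Pm /eqP E] j | Qm].
    have [a b c] := HP j _ (leA (h m) j) (Pm j).
    by rewrite -E ffunE inordK.
  split; first by apply/forallP => j; rewrite hK //; have [] := HQ j _ (leB m j) (Qm j).
  apply/eqP/ffunP => j; apply: val_inj; rewrite ffunE /= hK //.
  have [a b c] := HQ j _ (leB m j) (Qm j).
  by rewrite c inordK.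
congr F; apply: functional_extensionality => j; apply: hK.
have [a b c] := HP j _ (leA (h m) j) (Pm j).
by rewrite -E ffunE inordK.
Qed.

Lemma forall_true (T : finType) : [forall j : T, true].
Proof. exact/forallP. Qed.

Lemma box_restrict (T : Type) (idx : T) (op : Monoid.com_law idx) d M N (F : mi d -> T) :
  (N <= M)%N ->
  \big[op/idx]_(m : {ffun 'I_d -> 'I_M.+1} | [forall j, m j <= N]%N) F (fun j => m j)
  = \big[op/idx]_(m : {ffun 'I_d -> 'I_N.+1}) F (fun j => m j).
Proof.
move=> NM; rewrite (@box_reindex _ _ op d M N (fun _ m => m <= N)%N (fun _ _ => true)
  (fun _ m => m) (fun _ m => m)) => [|j m mN _|j m _ mN] //.
  by apply: eq_bigl => m; rewrite forall_true.
by rewrite (leq_trans mN NM).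
Qed.

Lemma box_even (T : Type) (idx : T) (op : Monoid.com_law idx) d N (F : mi d -> T) :
  (forall m, ~~ [forall j, ~~ odd (m j)] -> F m = idx) ->
  \big[op/idx]_(m : {ffun 'I_d -> 'I_N.+1}) F (fun j => m j)
  = \big[op/idx]_(m : {ffun 'I_d -> 'I_(N./2).+1}) F (mdouble (fun j => m j)).
Proof.
move=> HF.
rewrite (bigID (fun m : {ffun 'I_d -> 'I_N.+1} => [forall j, ~~ odd (m j)])) /=.
rewrite [X in op _ X]big1 => [|m]; last exact: HF.
rewrite Monoid.mulm1.
rewrite (@box_reindex _ _ op d N N./2 (fun _ m => ~~ odd m) (fun _ _ => true)
  (fun _ m => (2 * m)%N) (fun _ m => m./2)) => [|j m mN _|j m mN om].
- by apply: eq_bigl => m; rewrite forall_true.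
- by rewrite mul2n odd_double doubleK -geq_half_double.
- by rewrite mul2n halfK (negbTE om) subn0 half_leq.
Qed.

(** Exchange the two sums and put k = n - i: the range i <= n <= N becomes i + k <= N. *)
Lemma box_triangle (T : Type) (idx : T) (op : Monoid.com_law idx) d N (G : mi d -> mi d -> T) :
  \big[op/idx]_(n : {ffun 'I_d -> 'I_N.+1})
    \big[op/idx]_(i : {ffun 'I_d -> 'I_N.+1} | [forall j, i j <= n j]%N)
      G (fun j => i j) (fun j => n j - i j)%N
  = \big[op/idx]_(i : {ffun 'I_d -> 'I_N.+1})
    \big[op/idx]_(k : {ffun 'I_d -> 'I_N.+1} | [forall j, i j + k j <= N]%N)
      G (fun j => i j) (fun j => k j).
Proof.
rewrite (exchange_big_dep predT) //=; apply: eq_bigr => i _.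
rewrite (@box_reindex _ _ op d N N (fun j m => i j <= m)%N (fun j m => i j + m <= N)%N
  (fun j m => i j + m)%N (fun j m => m - i j)%N
  (fun n => G (fun j => i j) (fun j => n j - i j)%N)) => [|j m _ H|j m mN im].
- apply: eq_bigr => k _; congr (G _ _); apply: functional_extensionality => j.
  by rewrite addKn.
- by rewrite leq_addr addKn.
- by rewrite subnKC // (leq_trans (leq_subr _ _) mN).
Qed.

(** * Majorants and convergence of multi-indexed series *)

Lemma Rsum_le (I : finType) (P : pred I) (F G : I -> R) :
  (forall i, P i -> F i <= G i) ->
  \big[Rplus/0]_(i | P i) F i <= \big[Rplus/0]_(i | P i) G i.
Proof. by move=> H; apply: (big_ind2 Rle) => //; [apply: Rle_refl | move=> *; lra]. Qed.

Lemma Rsum_ge0 (I : finType) (P : pred I) (F : I -> R) :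
  (forall i, P i -> 0 <= F i) -> 0 <= \big[Rplus/0]_(i | P i) F i.
Proof. by move=> H; apply: (big_ind (Rle 0)) => //; [apply: Rle_refl | move=> *; lra]. Qed.

Lemma Rprod_ge0 (I : finType) (F : I -> R) :
  (forall i, 0 <= F i) -> 0 <= \big[Rmult/1]_i F i.
Proof. by move=> H; apply: (big_ind (Rle 0)) => //; [lra | exact: Rmult_le_pos]. Qed.

Lemma Rprod_le (I : finType) (F G : I -> R) :
  (forall i, 0 <= F i <= G i) -> \big[Rmult/1]_i F i <= \big[Rmult/1]_i G i.
Proof.
move=> H; suff [] : 0 <= \big[Rmult/1]_i F i <= \big[Rmult/1]_i G i by [].
apply: (big_ind2 (fun x y => 0 <= x <= y)) => //; first lra.
by move=> x1 x2 y1 y2 [? ?] [? ?]; split; [apply: Rmult_le_pos | apply: Rmult_le_compat].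
Qed.

Lemma Cmod_sum_le (I : finType) (P : pred I) (F : I -> C) (G : I -> R) :
  (forall i, P i -> Cmod (F i) <= G i) ->
  Cmod (\big[Cplus/RtoC 0]_(i | P i) F i) <= \big[Rplus/0]_(i | P i) G i.
Proof.
move=> H; apply: (big_ind2 (fun z r => Cmod z <= r)) => //; first by rewrite Cmod_0; lra.
by move=> z1 r1 z2 r2 ? ?; apply: Rle_trans (Cmod_triangle _ _) _; lra.
Qed.

Lemma RtoC_sum (I : finType) (P : pred I) (F : I -> R) :
  RtoC (\big[Rplus/0]_(i | P i) F i) = \big[Cplus/RtoC 0]_(i | P i) RtoC (F i).
Proof. exact: (big_morph RtoC RtoC_plus). Qed.

Definition rbox {d} (u : mi d -> R) (N : nat) : R :=
  \big[Rplus/0]_(m : {ffun 'I_d -> 'I_N.+1}) u (fun j => m j).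

Lemma rbox_ge0 d (u : mi d -> R) N : (forall n, 0 <= u n) -> 0 <= rbox u N.
Proof. by move=> u0; apply: Rsum_ge0. Qed.

Lemma rbox_mono d (u : mi d -> R) N M :
  (forall n, 0 <= u n) -> (N <= M)%N -> rbox u N <= rbox u M.
Proof.
move=> u0 NM; rewrite /rbox -(box_restrict _ u NM).
rewrite [X in _ <= X](bigID (fun m : {ffun 'I_d -> 'I_M.+1} => [forall j, m j <= N]%N)) /=.
set X := (X in _ <= _ + X); have : 0 <= X by apply: Rsum_ge0.
lra.
Qed.

Lemma rbox_le_lim d (u : mi d -> R) (U : R) N :
  (forall n, 0 <= u n) -> is_lim_seq (rbox u) U -> rbox u N <= U.
Proof.
move=> u0 HU; apply: (is_lim_seq_incr_compare _ _ HU) => n.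
exact: rbox_mono.
Qed.

(** Both differences are sums over the indices outside the small box, where the bound applies term
    by term. *)
Lemma Cmod_boxsum_diff d (a : mi d -> C) (w : mi d -> R) N M :
  (forall n, Cmod (a n) <= w n) -> (N <= M)%N ->
  Cmod (boxsum a M - boxsum a N) <= rbox w M - rbox w N.
Proof.
move=> aw NM; rewrite /boxsum /rbox -(box_restrict _ a NM) -(box_restrict _ w NM).
pose P (m : {ffun 'I_d -> 'I_M.+1}) := [forall j, m j <= N]%N.
rewrite (bigID P) /= [X in _ <= X - _](bigID P) /=.
set s := \big[Cplus/_]_(_ | P _) _; set t := \big[Cplus/_]_(_ | _) _.
set s' := \big[Rplus/_]_(_ | P _) _; set t' := \big[Rplus/_]_(_ | _) _.
have -> : (s + t - s)%C = t by ring.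
have -> : s' + t' - s' = t' by ring.
by apply: Cmod_sum_le.
Qed.

Lemma filterlim_Cmod (v : nat -> C) (l : C) :
  filterlim v eventually (locally l) <-> is_lim_seq (fun n => Cmod (v n - l)) 0.
Proof.
split=> [H|H].
  apply/is_lim_seq_spec => eps.
  (* Neighbourhoods in C are coordinatewise, and [Cmod] is at most sqrt 2 < 2 times the larger
     coordinate; half of [eps] suffices. *)
  pose e2 := pos_div_2 eps.
  move/filterlim_locally: H => /(_ e2); apply: filter_imp => n [H1 H2].
  rewrite Rminus_0_r Rabs_pos_eq; last exact: Cmod_ge_0.
  apply: Rle_lt_trans (Cmod_2Rmax _) _.
  have s2 : sqrt 2 < 2 by have := sqrt_sqrt 2; have := sqrt_pos 2; nra.
  have : Rmax (Rabs (v n - l)%C.1) (Rabs (v n - l)%C.2) < e2 by apply: Rmax_lub_lt.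
  have := sqrt_pos 2; have := Rabs_pos (v n - l)%C.1; have := Rmax_l (Rabs (v n - l)%C.1) (Rabs (v n - l)%C.2).
  rewrite /e2 /=; nra.
apply/filterlim_locally => eps; move/is_lim_seq_spec: H => /(_ eps).
apply: filter_imp => n; rewrite Rminus_0_r Rabs_pos_eq; last exact: Cmod_ge_0.
move=> H; have := Rmax_Cmod (v n - l)%C => H2.
by split; [apply: Rle_lt_trans (Rmax_l _ _) (Rle_lt_trans _ _ _ H2 H)
          |apply: Rle_lt_trans (Rmax_r _ _) (Rle_lt_trans _ _ _ H2 H)].
Qed.

(** Total because [Lim_seq] is; it is the sum of the series once the box sums converge. *)
Definition msum {d} (a : mi d -> C) : C :=
  (real (Lim_seq (fun N => (boxsum a N).1)), real (Lim_seq (fun N => (boxsum a N).2))).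

(** A convergent [W] is Cauchy, and its increments control those of [v]. *)
Lemma cauchy_dominated (v W : nat -> R) (l : R) :
  is_lim_seq W l ->
  (forall N M, (N <= M)%N -> Rabs (v M - v N) <= W M - W N) ->
  is_lim_seq v (real (Lim_seq v)).
Proof.
move=> HW H; apply: Lim_seq_correct'; apply/ex_lim_seq_cauchy_corr => eps.
have [N0 HN0] := proj1 (ex_lim_seq_cauchy_corr W) (ex_intro _ l HW) eps.
exists N0 => n m /leP Hn /leP Hm.
wlog nm : n m Hn Hm / (n <= m)%N => [Hw|].
  by have [?|/ltnW ?] := leqP n m; [|rewrite Rabs_minus_sym]; apply: Hw.
rewrite Rabs_minus_sym; apply: Rle_lt_trans (H _ _ nm) _.
by apply: Rle_lt_trans (HN0 m n _ _); [apply: Rle_abs | apply/leP..].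
Qed.

Lemma rbox_lim_ge0 d (u : mi d -> R) (U : R) :
  (forall n, 0 <= u n) -> is_lim_seq (rbox u) U -> 0 <= U.
Proof. by move=> u0 /(rbox_le_lim 0 u0); apply: Rle_trans; apply: rbox_ge0. Qed.

Lemma msum_dominated d (a : mi d -> C) (w : mi d -> R) (W : R) :
  (forall n, Cmod (a n) <= w n) -> is_lim_seq (rbox w) W ->
  has_msum a (msum a) /\ forall N, Cmod (msum a - boxsum a N) <= W - rbox w N.
Proof.
move=> aw HW.
have w0 n : 0 <= w n := Rle_trans _ _ _ (Cmod_ge_0 _) (aw n).
have D N M : (N <= M)%N -> Cmod (boxsum a M - boxsum a N) <= rbox w M - rbox w N.
  exact: Cmod_boxsum_diff.
have H1 : is_lim_seq (fun N => (boxsum a N).1) (msum a).1.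
  apply: (cauchy_dominated HW) => N M /D; apply: Rle_trans.
  exact: Rle_trans (Rmax_l _ _) (Rmax_Cmod (boxsum a M - boxsum a N)%C).
have H2 : is_lim_seq (fun N => (boxsum a N).2) (msum a).2.
  apply: (cauchy_dominated HW) => N M /D; apply: Rle_trans.
  exact: Rle_trans (Rmax_r _ _) (Rmax_Cmod (boxsum a M - boxsum a N)%C).
have HL : filterlim (boxsum a) eventually (locally (msum a)).
  apply/filterlim_locally => eps.
  move/filterlim_locally: H1 => /(_ eps) H1; move/filterlim_locally: H2 => /(_ eps) H2.
  by apply: filter_imp (filter_and _ _ H1 H2) => n [].
split.
  split=> //; exists W => N; apply: Rle_trans (rbox_le_lim N w0 HW).
  exact: Rsum_le.
move=> N; move/filterlim_Cmod: HL => HL.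
(* The tail bound comes from comparing the boxes [N] and [M] and letting [M] tend to infinity. *)
have HR : is_lim_seq (fun M => Cmod (boxsum a M - msum a) + (rbox w M - rbox w N)) (W - rbox w N).
  have := is_lim_seq_plus' _ _ _ _ HL (is_lim_seq_minus' _ _ _ _ HW (is_lim_seq_const (rbox w N))).
  by rewrite Rplus_0_l.
apply: (is_lim_seq_le_loc (fun=> Cmod (msum a - boxsum a N)) _ (Rbar.Finite _) (Rbar.Finite _) _ (is_lim_seq_const _) HR).
exists N => M /leP NM; apply: Rle_trans (Rplus_le_compat_l _ _ _ (D _ _ NM)).
have -> : (msum a - boxsum a N = - (boxsum a M - msum a) + (boxsum a M - boxsum a N))%C by ring.
by apply: Rle_trans (Cmod_triangle _ _) _; rewrite Cmod_opp; apply: Rle_refl.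
Qed.

Lemma Cmod_msum_le d (a : mi d -> C) (w : mi d -> R) (W : R) :
  (forall n, Cmod (a n) <= w n) -> is_lim_seq (rbox w) W -> Cmod (msum a) <= W.
Proof.
move=> aw HW; have [_ /(_ 0%N) H] := msum_dominated aw HW.
have H0 : Cmod (boxsum a 0) <= rbox w 0 by apply: Cmod_sum_le.
have -> : msum a = ((msum a - boxsum a 0) + boxsum a 0)%C by ring.
by apply: Rle_trans (Cmod_triangle _ _) _; lra.
Qed.

(* The missing part of the square box is covered by the pairs outside the half-size box. *)
Lemma triangle_complement d (u w : mi d -> R) N :
  (forall i, 0 <= u i) -> (forall k, 0 <= w k) ->
  \big[Rplus/0]_(i : {ffun 'I_d -> 'I_N.+1})
    \big[Rplus/0]_(k : {ffun 'I_d -> 'I_N.+1} | ~~ [forall j, i j + k j <= N]%N)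
      (u (fun j => i j) * w (fun j => k j))
  <= rbox u N * rbox w N - rbox u N./2 * rbox w N./2.
Proof.
move=> u0 w0.
have NN : (N./2 <= N)%N by rewrite leq_half_double -addnn -addnS leq_addr.
pose T := {ffun 'I_d -> 'I_N.+1}.
have E : rbox u N * rbox w N = \big[Rplus/0]_(i : T) \big[Rplus/0]_(k : T)
      (u (fun j => i j) * w (fun j => k j)).
  by rewrite /rbox big_distrl; apply: eq_bigr => i _; rewrite big_distrr.
pose P (i k : T) := [forall j, i j + k j <= N]%N.
have {}E : rbox u N * rbox w N =
    \big[Rplus/0]_(i : T) \big[Rplus/0]_(k : T | P i k) (u (fun j => i j) * w (fun j => k j)) +
    \big[Rplus/0]_(i : T) \big[Rplus/0]_(k : T | ~~ P i k) (u (fun j => i j) * w (fun j => k j)).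
  by rewrite E -big_split; apply: eq_bigr => i _; rewrite (bigID (P i)).
rewrite E; set X := (X in X + _ - _); set V := (V in X + V - _).
(* Two indices of size at most [N./2] add up to at most [N], so the half-size square lies inside the
   triangle. *)
suff H : rbox u N./2 * rbox w N./2 <= X.
  by apply: (Rle_trans _ V); [exact: Rle_refl | lra].
pose Q (i : T) := [forall j, i j <= N./2]%N.
rewrite /rbox -(box_restrict _ u NN) -(box_restrict _ w NN) big_distrl /=.
rewrite /X [Y in _ <= Y](bigID Q) /=.
set Y := (Y in _ <= _ + Y); have Y0 : 0 <= Y.
  by apply: Rsum_ge0 => i _; apply: Rsum_ge0 => k _; apply: Rmult_le_pos.
apply: (Rle_trans _ (_ + 0)); last exact: Rplus_le_compat_l Y0.
rewrite Rplus_0_r; apply: Rsum_le => i /forallP Qi.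
rewrite big_distrr /= [X in _ <= X](bigID Q) /=.
set Z := (Z in _ <= _ + Z); have Z0 : 0 <= Z.
  by apply: Rsum_ge0 => k _; apply: Rmult_le_pos.
apply: (Rle_trans _ (_ + 0)); last exact: Rplus_le_compat_l Z0.
rewrite Rplus_0_r; apply: Req_le; apply: eq_bigl => k.
rewrite andb_idl // => /forallP Qk; apply/forallP => j.
apply: leq_trans (leq_add (Qi j) (Qk j)) _.
by rewrite addnn -[X in (_ <= X)%N](odd_double_half N) leq_addl.
Qed.

Lemma filterlim_half : filterlim half eventually eventually.
Proof.
move=> P [N HN]; exists N.*2 => n /leP Hn; apply: HN; apply/leP.
by rewrite geq_half_double.
Qed.

(** [S i] is the sum of row i of [g]. Its truncation error is at most u_i times a tail of [w], and
    the pairs missing from the triangle are controlled by [triangle_complement]; both errors tend to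
    0. *)
Lemma msum_triangle d (g : mi d -> mi d -> C) (S : mi d -> C) (u w : mi d -> R) (U W : R) :
  (forall i, 0 <= u i) -> (forall k, 0 <= w k) ->
  (forall i k, Cmod (g i k) <= u i * w k) ->
  is_lim_seq (rbox u) U -> is_lim_seq (rbox w) W ->
  (forall i N, Cmod (S i - boxsum (g i) N) <= u i * (W - rbox w N)) ->
  is_lim_seq (fun N => Cmod (boxsum S N -
    \big[Cplus/RtoC 0]_(i : {ffun 'I_d -> 'I_N.+1})
      \big[Cplus/RtoC 0]_(k : {ffun 'I_d -> 'I_N.+1} | [forall j, i j + k j <= N]%N)
        g (fun j => i j) (fun j => k j))) 0.
Proof.
move=> u0 w0 guw HU HW HS.
have HU2 := filterlim_comp _ _ _ _ _ _ _ _ filterlim_half HU.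
have HW2 := filterlim_comp _ _ _ _ _ _ _ _ filterlim_half HW.
apply: (is_lim_seq_le_le (fun=> 0) _
  (fun N => rbox u N * (W - rbox w N) +
            (rbox u N * rbox w N - rbox u N./2 * rbox w N./2))).
- move=> N; split; first exact: Cmod_ge_0.
  pose T := {ffun 'I_d -> 'I_N.+1}.
  pose P (i k : T) := [forall j, i j + k j <= N]%N.
  apply: Rle_trans (Rplus_le_compat_l _ _ _ (triangle_complement N u0 w0)).
  (* The sum over the square is inserted between the full rows and the triangle. *)
  pose G := \big[Cplus/RtoC 0]_(i : T) boxsum (g (fun j => i j)) N.
  pose G' := \big[Cplus/RtoC 0]_(i : T) \big[Cplus/RtoC 0]_(k : T | ~~ P i k)
                g (fun j => i j) (fun j => k j).
  set G'' := \big[Cplus/_]_i \big[Cplus/_]_(_ | _) _.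
  have EG : G = (G'' + G')%C.
    by rewrite -big_split; apply: eq_bigr => i _; rewrite /boxsum (bigID (P i)).
  have -> : (boxsum S N - G'' = (boxsum S N + (- RtoC 1) * G) + G')%C.
    by rewrite EG; ring.
  apply: Rle_trans (Cmod_triangle _ _) _; apply: Rplus_le_compat.
    rewrite /G big_distrr -big_split /rbox big_distrl /=.
    apply: Cmod_sum_le => i _; have := HS (fun j => i j) N.
    by have -> : forall z t : C, (z + - RtoC 1 * t = z - t)%C by move=> *; ring.
  by apply: Cmod_sum_le => i _; apply: Cmod_sum_le => k _.
- exact: is_lim_seq_const.
(* The limit of the majorant is U (W - W) + (U W - U W). *)
- have := is_lim_seq_plus' _ _ _ _
    (is_lim_seq_mult' _ _ _ _ HU (is_lim_seq_minus' _ _ _ _ (is_lim_seq_const W) HW))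
    (is_lim_seq_minus' _ _ _ _ (is_lim_seq_mult' _ _ _ _ HU HW)
                               (is_lim_seq_mult' _ _ _ _ HU2 HW2)).
  by congr is_lim_seq; congr Rbar.Finite; ring.
Qed.

(** * Families that factor over the coordinates *)

Definition sepmi {d} (F : 'I_d -> nat -> R) (n : mi d) : R := \big[Rmult/1]_(j < d) F j (n j).

Lemma sepmi_ge0 d (F : 'I_d -> nat -> R) n : (forall j m, 0 <= F j m) -> 0 <= sepmi F n.
Proof. by move=> F0; apply: Rprod_ge0. Qed.

Lemma rbox_sepmi d (F : 'I_d -> nat -> R) N :
  rbox (sepmi F) N = \big[Rmult/1]_(j < d) \big[Rplus/0]_(i < N.+1) F j i.
Proof. by rewrite [RHS]bigA_distr_bigA. Qed.

Lemma sum_n_big (F : nat -> R) N : sum_n F N = \big[Rplus/0]_(i < N.+1) F i.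
Proof.
elim: N => [|N IH]; first by rewrite sum_O big_ord1.
by rewrite sum_Sn IH [RHS]big_ord_recr.
Qed.

(** The box sum is a product of one-variable partial sums, so the limit is taken factor by factor,
    by induction on the list of coordinates. *)
Lemma rbox_sepmi_lim d (F : 'I_d -> nat -> R) :
  (forall j, ex_series (F j)) ->
  is_lim_seq (rbox (sepmi F)) (\big[Rmult/1]_(j < d) Series (F j)).
Proof.
move=> HF; apply: (is_lim_seq_ext (fun N => \big[Rmult/1]_(j < d) sum_n (F j) N)) => [N|].
  by rewrite rbox_sepmi; apply: eq_bigr => j _; rewrite sum_n_big.
elim: (index_enum 'I_d) => [|j r IH].
  rewrite big_nil; apply: is_lim_seq_ext (is_lim_seq_const 1) => N.
  by rewrite big_nil.
rewrite big_cons.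
apply: (is_lim_seq_ext (fun N => sum_n (F j) N * \big[Rmult/1]_(i <- r) sum_n (F i) N)) => [N|].
  by rewrite big_cons.
by apply: is_lim_seq_mult' IH; apply: (Series_correct (F j)).
Qed.

(** * Factorially decaying weights *)

(** The decay that [ell_flat] imposes in one coordinate, with q = 1 / h and s = 1 / (2 tau). *)
Definition weight (q s : R) (m : nat) : R := q ^ m * Rpower (INR m`!) (- s).

Lemma weight_gt0 q s m : 0 < q -> 0 < weight q s m.
Proof. by move=> q0; apply: Rmult_lt_0_compat; [apply: pow_lt | apply: exp_pos]. Qed.

(** Since (m + n)! is m! n! times a positive binomial coefficient. This separates the two summation
    indices. *)
Lemma weight_add q s m n : 0 < q -> 0 < s ->
  weight q s (m + n) <= weight q s m * weight q s n.
Proof.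
move=> q0 s0; rewrite /weight pow_add.
have mf := INR_fact_gt0 m; have nf := INR_fact_gt0 n.
have : Rpower (INR (m + n)`!) (- s) <= Rpower (INR m`!) (- s) * Rpower (INR n`!) (- s).
  rewrite Rpower_mult_distr // !Rpower_Ropp; apply: Rinv_le_contravar; first exact: exp_pos.
  apply: Rle_Rpower_l; first lra.
  split; first exact: Rmult_lt_0_compat.
  rewrite -mult_INR; apply/le_INR/leP.
  by rewrite -(bin_fact (leq_addr n m)) addKn leq_pmull // bin_gt0 leq_addr.
have := pow_lt _ m q0; have := pow_lt _ n q0 => qn qm H.
have := Rmult_le_compat_l _ _ _ (Rlt_le _ _ (Rmult_lt_0_compat _ _ qm qn)) H.
lra.
Qed.

(** Ratio test: consecutive weights have quotient q (m + 1)^(-s), which tends to 0. *)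
Lemma ex_series_weight A q s : 0 < q -> 0 < s -> ex_series (fun m => A * weight q s m).
Proof.
move=> q0 s0; apply: (ex_series_scal A).
apply: (ex_series_ext (fun m => Rabs (weight q s m))) => [m|].
  by rewrite Rabs_pos_eq //; apply/Rlt_le/weight_gt0.
apply: (@ex_series_DAlembert (weight q s) 0); first lra.
  by move=> m; apply/Rgt_not_eq/weight_gt0.
apply: (is_lim_seq_ext (fun m => q * exp (- s * ln (INR m.+1)))) => [m|].
  have mf := INR_fact_gt0 m; have m0 := pos_INR m.
  have -> : weight q s m.+1 / weight q s m = q * exp (- s * ln (INR m.+1)).
    rewrite /weight INR_factS -S_INR -Rpower_mult_distr //; last by rewrite S_INR; lra.
    rewrite -/(Rpower (INR m.+1) (- s)).
    have := exp_pos (- s * ln (INR m`!)); rewrite -/(Rpower _ _) => r0.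
    have := pow_lt _ m q0 => qm; rewrite [q ^ m.+1]/=.
    by field; lra.
  by rewrite Rabs_pos_eq //; apply: Rmult_le_pos; [lra | apply/Rlt_le/exp_pos].
have -> : Rbar.Finite 0 = Rbar_mult q 0 by rewrite /= Rmult_0_r.
apply: is_lim_seq_scal_l.
apply: (is_lim_comp_seq exp _ m_infty); first exact: is_lim_exp_m.
  by exists 0%N.
have -> : m_infty = Rbar_mult (- s) p_infty.
  rewrite /=; case: Rle_dec => [H|//]; exfalso; lra.
apply: is_lim_seq_scal_l; apply: (is_lim_comp_seq ln _ p_infty); first exact: is_lim_ln_p.
  by exists 0%N.
exact: (proj1 (is_lim_seq_incr_1 INR _) is_lim_seq_INR).
Qed.

(** (2m)! is (2m)!! (2m-1)!!, and the first factor, 2^m m!, dominates the second. *)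
Lemma fact_double_le m : INR (2 * m)`! <= (2 ^ m * INR m`!) ^ 2.
Proof.
elim: m => [|m IH]; first by rewrite muln0 fact0 /=; lra.
rewrite mulnS !INR_factS S_INR mult_INR [INR 2]/= [2 ^ m.+1]/=.
set X := INR (2 * m)`! in IH *; set Y := 2 ^ m * INR m`! in IH.
have n0 := pos_INR m; have X0 : 0 < X := INR_fact_gt0 _.
have -> : (2 * 2 ^ m * ((INR m + 1) * INR m`!)) ^ 2 = (2 * (INR m + 1)) ^ 2 * Y ^ 2.
  by rewrite /Y; ring.
apply: (Rle_trans _ ((2 * (INR m + 1)) ^ 2 * X)); last first.
  by apply: Rmult_le_compat_l IH; apply: pow2_ge_0.
rewrite -Rmult_assoc; apply: Rmult_le_compat_r; first lra.
nra.
Qed.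

(** The passage from index n to 2n halves the exponent of the factorial: (2m)!^(s/2) <= 2^(s m)
    m!^s. The radius under the square root is chosen so that its power 2m cancels q^m 2^(s m). *)
Lemma weight_double q s m : 0 < q -> 0 < s ->
  weight q s m * (sqrt (/ (q * Rpower 2 s)) ^ (2 * m) * Rpower (INR (2 * m)`!) (s / 2)) <= 1.
Proof.
move=> q0 s0; have E0 : 0 < Rpower 2 s by apply: exp_pos.
have mf := INR_fact_gt0 m.
have I0 : 0 < / (q * Rpower 2 s) by apply/Rinv_0_lt_compat/Rmult_lt_0_compat.
rewrite pow_mult [_ ^ 2]/= Rmult_1_r sqrt_sqrt; last lra.
have P2 : 0 < 2 ^ m by apply: pow_lt; lra.
have H : Rpower (INR (2 * m)`!) (s / 2) <= Rpower 2 s ^ m * Rpower (INR m`!) s.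
  apply: (Rle_trans _ (Rpower ((2 ^ m * INR m`!) ^ 2) (s / 2))).
    apply: Rle_Rpower_l; first lra.
    by split; [exact: INR_fact_gt0 | exact: fact_double_le].
  apply: Req_le; rewrite -Rpower_pow; last exact: Rmult_lt_0_compat.
  rewrite Rpower_mult [INR 2]/=.
  have -> : 2 * (s / 2) = s by field.
  rewrite -Rpower_mult_distr // -Rpower_pow; last lra.
  by rewrite Rpower_mult -Rpower_pow // Rpower_mult Rmult_comm [s * _]Rmult_comm Rmult_comm.
rewrite /weight Rpower_Ropp pow_inv Rpow_mult_distr.
have F0 : 0 < Rpower (INR m`!) s by apply: exp_pos.
have Q0 : 0 < q ^ m by apply: pow_lt.
have R0 : 0 < Rpower 2 s ^ m by apply: pow_lt.
set Z := Rpower (INR (2 * m)`!) (s / 2) in H *.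
have -> : q ^ m * / Rpower (INR m`!) s * (/ (q ^ m * Rpower 2 s ^ m) * Z) =
          Z / (Rpower 2 s ^ m * Rpower (INR m`!) s) by field; lra.
by apply/Rle_div_l; [apply: Rmult_lt_0_compat | lra].
Qed.

(** * From one coordinate to multi-indices *)

Lemma pow_mabs d (h : R) (n : mi d) : h ^ mabs n = sepmi (fun _ m => h ^ m) n.
Proof. by rewrite /mabs (big_morph (pow h) (pow_add h) (pow_O h)). Qed.

Lemma INR_prod (I : finType) (F : I -> nat) :
  INR (\prod_i F i) = \big[Rmult/1]_i INR (F i).
Proof. exact: (big_morph INR mult_INR). Qed.

Lemma Rpower_prod (I : finType) (F : I -> R) s : (forall i, 0 < F i) ->
  Rpower (\big[Rmult/1]_i F i) s = \big[Rmult/1]_i Rpower (F i) s.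
Proof.
move=> F0; suff [] : 0 < \big[Rmult/1]_i F i /\
  Rpower (\big[Rmult/1]_i F i) s = \big[Rmult/1]_i Rpower (F i) s by [].
apply: (big_ind2 (fun x y => 0 < x /\ Rpower x s = y)) => [|x1 x2 y1 y2 [? <-] [? <-]|//].
  by split; [lra | rewrite /Rpower ln_1 Rmult_0_r exp_0].
by split; [apply: Rmult_lt_0_compat | rewrite Rpower_mult_distr].
Qed.

Lemma sqrt_prod (I : finType) (F : I -> R) : (forall i, 0 < F i) ->
  sqrt (\big[Rmult/1]_i F i) = \big[Rmult/1]_i sqrt (F i).
Proof.
move=> F0; suff [] : 0 < \big[Rmult/1]_i F i /\
  sqrt (\big[Rmult/1]_i F i) = \big[Rmult/1]_i sqrt (F i) by [].
apply: (big_ind2 (fun x y => 0 < x /\ sqrt x = y)) => [|x1 x2 y1 y2 [? <-] [? <-]|//].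
  by split; [lra | apply: sqrt_1].
by split; [apply: Rmult_lt_0_compat | rewrite sqrt_mult; lra].
Qed.

Lemma sepmi_mul d (F G : 'I_d -> nat -> R) n :
  sepmi F n * sepmi G n = sepmi (fun j m => F j m * G j m) n.
Proof. by rewrite /sepmi big_split. Qed.

Lemma Rpower_mfact d s (n : mi d) :
  Rpower (INR (mfact n)) s = sepmi (fun _ m => Rpower (INR m`!) s) n.
Proof. by rewrite INR_prod Rpower_prod // => j; apply: INR_fact_gt0. Qed.

Lemma ell_flat_weight d sigma (a : mi d -> C) : 0 < sigma -> ell_flat (sigma / 2) a ->
  exists q M, 0 < q /\ 0 <= M /\
    forall n, Cmod (a n) <= M * sepmi (fun _ => weight q (/ sigma)) n.
Proof.
move=> s0 [h [h0 [M HM]]]; exists (/ h), M.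
split; first exact: Rinv_0_lt_compat.
split.
  (* The bound at the zero multi-index has a nonnegative left side. *)
  apply: Rle_trans (HM (fun _ => 0%N)); apply: Rmult_le_pos; last exact/Rlt_le/exp_pos.
  by apply: Rmult_le_pos; [exact: Cmod_ge_0 | apply: pow_le; lra].
move=> n; have := HM n.
have -> : 2 * (sigma / 2) = sigma by field.
have -> : sepmi (fun _ => weight (/ h) (/ sigma)) n =
    / (h ^ mabs n * Rpower (INR (mfact n)) (/ sigma)).
  rewrite Rinv_mult -pow_inv -Rpower_Ropp pow_mabs Rpower_mfact sepmi_mul.
  by [].
have p1 : 0 < h ^ mabs n by apply: pow_lt.
have p2 : 0 < Rpower (INR (mfact n)) (/ sigma) by apply: exp_pos.
move=> H; apply: (Rmult_le_reg_r (h ^ mabs n * Rpower (INR (mfact n)) (/ sigma))).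
  exact: Rmult_lt_0_compat.
rewrite (Rmult_assoc M) Rinv_l; first by lra.
by apply/Rgt_not_eq/Rmult_lt_0_compat.
Qed.

(** * The coefficients [bcoef] *)

(** The factor of [bcoef] belonging to one coordinate; the exponent d/4 of [PI] gives 1/4 to
    each. *)
Definition bcoef1 (m : nat) : R :=
  (-1) ^ m * Rpower PI (/ 4) * sqrt (INR (2 * m)`!) / (2 ^ m * INR m`!).

Lemma bcoefE d (n : mi d) : bcoef n = sepmi (fun _ => bcoef1) n.
Proof.
have E : Rpower PI (INR d / 4) = \big[Rmult/1]_(j < d) Rpower PI (/ 4).
  elim: d {n} => [|d IH].
    by rewrite big_ord0 /= Rdiv_0_l Rpower_O //; apply: PI_RGT_0.
  by rewrite big_ord_recr -IH -[RHS]Rpower_plus S_INR; congr Rpower; field.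
have Einv (F : 'I_d -> R) : / (\big[Rmult/1]_j F j) = \big[Rmult/1]_j / F j.
  by apply: (big_morph Rinv); [exact: Rinv_mult | exact: Rinv_1].
rewrite /bcoef E /Rdiv Rinv_mult !pow_mabs !INR_prod sqrt_prod; last first.
  by move=> j; apply: INR_fact_gt0.
rewrite /sepmi !Einv -!big_split; apply: eq_bigr => j _ /=.
by rewrite /bcoef1 /Rdiv Rinv_mult.
Qed.

(** By [fact_double_le], the root of (2m)! is at most 2^m m!. *)
Lemma bcoef1_bound m : Rabs (bcoef1 m) <= Rpower PI (/ 4).
Proof.
have P0 : 0 < Rpower PI (/ 4) by apply: exp_pos.
have mf := INR_fact_gt0 m; have P2 : 0 < 2 ^ m by apply: pow_lt; lra.
have D0 : 0 < 2 ^ m * INR m`! by apply: Rmult_lt_0_compat.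
rewrite /bcoef1 Rabs_div ?Rabs_mult; last lra.
rewrite pow_1_abs Rmult_1_l (Rabs_pos_eq (sqrt _)); last exact: sqrt_pos.
rewrite (Rabs_pos_eq (Rpower _ _)) 1?(Rabs_pos_eq (2 ^ m)) 1?(Rabs_pos_eq (INR _)); try lra.
apply/Rle_div_l => //; apply: Rmult_le_compat_l; first lra.
rewrite -[X in _ <= X]sqrt_pow2; last lra.
exact/sqrt_le_1_alt/fact_double_le.
Qed.

(** The Hermite normalisation is 2^m sqrt((2m)!) PI^(1/4); it cancels all of [bcoef1] except (-1)^m
    / (2^m m!), and the extra 2^m completes 4^m. *)
Lemma bcoef1_hermite m x :
  bcoef1 m * (/ sqrt (2 ^ (2 * m) * INR (2 * m)`! * sqrt PI) * exp (- x ^ 2 / 2) * hermite (2 * m) x)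
  = ehermite m x * exp (- x ^ 2 / 2).
Proof.
have PI0 := PI_RGT_0; have mf := INR_fact_gt0 m; have m2f := INR_fact_gt0 (2 * m).
have P2 : 0 < 2 ^ m by apply: pow_lt; lra.
have sP : 0 < sqrt PI by apply: sqrt_lt_R0.
have E1 : 2 ^ (2 * m) = 2 ^ m * 2 ^ m by rewrite mul2n -addnn pow_add.
have E4 : 4 ^ m = 2 ^ m * 2 ^ m by rewrite -Rpow_mult_distr; congr (_ ^ _); ring.
have E2 : Rpower PI (/ 4) = sqrt (sqrt PI).
  by rewrite -(Rpower_sqrt (sqrt PI)) // -(Rpower_sqrt PI) // Rpower_mult; congr Rpower; field.
have F0 : 0 < sqrt (INR (2 * m)`!) by apply: sqrt_lt_R0.
have G0 : 0 < sqrt (sqrt PI) by apply: sqrt_lt_R0.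
rewrite E1 (sqrt_mult _ (sqrt PI)) 1?(sqrt_mult _ (INR _)) ?sqrt_square; try nra.
by rewrite /bcoef1 /ehermite E2 E4; field; lra.
Qed.

Definition ehfun {d} (x : pt d) : mi d -> R :=
  sepmi (fun j m => ehermite m (x j) * exp (- x j ^ 2 / 2)).

Lemma bcoef_hfun d (n : mi d) (x : pt d) : bcoef n * hfun (mdouble n) x = ehfun x n.
Proof.
rewrite bcoefE /hfun /sepmi -big_split; apply: eq_bigr => j _ /=.
exact: bcoef1_hermite.
Qed.

(** The Gaussian factor is at most 1 and is dropped; the rest is [ehermite_growth]. *)
Lemma ehfun_bound d (x : pt d) (n : mi d) :
  Rabs (ehfun x n) <=
  sepmi (fun j m => (1 + 2 * Rabs (x j)) * ((1 + 2 * Rabs (x j)) ^ 2) ^ m) n.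
Proof.
rewrite /ehfun /sepmi (big_morph Rabs Rabs_mult Rabs_R1); apply: Rprod_le => j.
split; first exact: Rabs_pos.
have G := ehermite_growth (n j) (x j).
rewrite Rabs_mult (Rabs_pos_eq (exp _)); last exact/Rlt_le/exp_pos.
have E1 : exp (- x j ^ 2 / 2) <= 1.
  rewrite -exp_0; have [H|->] : - x j ^ 2 / 2 <= 0 by have := pow2_ge_0 (x j); lra.
    exact/Rlt_le/exp_increasing.
  exact: Rle_refl.
apply: (Rle_trans _ (Rabs (ehermite (n j) (x j)) * 1)); last by rewrite Rmult_1_r.
by apply: Rmult_le_compat_l E1; apply: Rabs_pos.
Qed.

Lemma mbinom_half_bounds d (k : mi d) : 0 <= mbinom_half k <= 1.
Proof.
split; first by apply: Rprod_ge0 => j; case: (cbin_bounds (k j)).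
apply: (Rle_trans _ (\big[Rmult/1]_(j < d) 1)); last by rewrite big1 //; apply: Rle_refl.
by apply: Rprod_le => j; apply: cbin_bounds.
Qed.

(** * Expansion at squares *)

Lemma lfun_vsq d N (n : {ffun 'I_d -> 'I_N.+1}) (x : pt d) :
  lfun (fun j => n j) (vsq x) =
  \big[Rplus/0]_(i : {ffun 'I_d -> 'I_N.+1} | [forall j, i j <= n j]%N)
     (mbinom_half (fun j => n j - i j)%N * ehfun x (fun j => i j)).
Proof.
transitivity (\big[Rmult/1]_(j < d) \big[Rplus/0]_(i < N.+1 | (i <= n j)%N)
    (cbin (n j - i) * (ehermite i (x j) * exp (- x j ^ 2 / 2)))).
  apply: eq_bigr => j _; rewrite /vsq laguerre_sq big_distrl.
  (* All coordinates get the same index type, with the bound i <= n_j as a filter, so that the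
     product of sums can be expanded over functions. *)
  rewrite (big_ord_widen N.+1 (fun i => (cbin (n j - i) * ehermite i (x j)) * exp (- x j ^ 2 / 2))) //.
  by apply: eq_big => i; rewrite ?ltnS // => _; rewrite Rmult_assoc.
rewrite (bigA_distr_big_dep (fun j (i : 'I_N.+1) => i <= n j)%N).
apply: eq_big => [i|i _]; first exact/familyP/forallP.
by rewrite /mbinom_half /ehfun /sepmi -big_split.
Qed.

Lemma even_ext_double d (b : mi d -> C) n : even_ext b (mdouble n) = b n.
Proof.
rewrite /even_ext ifT; last by apply/forallP => j; rewrite /mdouble mul2n odd_double.
by congr b; apply: functional_extensionality => j; rewrite /mdouble mul2n doubleK.
Qed.

(** Only even multi-indices contribute, so the box of size [N] carries the box of size [N./2] of the
    original series, and [N./2] tends to infinity. *)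
Lemma has_msum_even_ext d (b : mi d -> C) (phi : mi d -> R) s :
  has_msum (fun n => Cmult (b n) (RtoC (phi (mdouble n)))) s ->
  has_msum (fun m => Cmult (even_ext b m) (RtoC (phi m))) s.
Proof.
pose F m := Cmult (even_ext b m) (RtoC (phi m)); rewrite -/F.
have F0 m : ~~ [forall j, ~~ odd (m j)] -> F m = RtoC 0.
  by rewrite /F /even_ext => /negbTE ->; rewrite Cmult_0_l.
have E : (fun n => Cmult (b n) (RtoC (phi (mdouble n)))) = (fun n => F (mdouble n)).
  by apply: functional_extensionality => n; rewrite /F even_ext_double.
rewrite {}E => -[[M HM] HL]; split.
  exists M => N; rewrite (box_even _ _ (F := fun m => Cmod (F m))) => [|m /F0 ->].
    exact: HM.
  exact: Cmod_0.
apply: (filterlim_ext (fun N => boxsum (fun n => F (mdouble n)) N./2)) => [N|].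
  by rewrite [RHS](box_even _ _ F0).
exact: filterlim_comp filterlim_half HL.
Qed.

(* b2 n stands for b_{2n}; S n = sum_k a_{k+n}(f) binom(k - 1/2, k). *)
Theorem theorem6p4 (d : nat) (sigma : R) (f : pt d -> C) (a : mi d -> C) :
  (0 < sigma)%R ->
  ell_flat (sigma / 2) a ->
  (forall x, nonneg_pt x -> has_msum (fun n => Cmult (a n) (RtoC (lfun n x))) (f x)) ->
  exists S : mi d -> C,
    (forall n : mi d,
       has_msum (fun k => Cmult (a (madd k n)) (RtoC (mbinom_half k))) (S n)) /\
    let b2 := fun n : mi d => Cmult (RtoC (bcoef n)) (S n) in
    ell_flat sigma (even_ext b2) /\
    H_flat_even sigma (fun x => f (vsq x)) /\
    (forall x : pt d,
       has_msum (fun n => Cmult (b2 n) (RtoC (hfun (mdouble n) x))) (f (vsq x))).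
Proof.
move=> s0 Ha Hf.
have is0 : 0 < / sigma by apply: Rinv_0_lt_compat.
have [q [M [q0 [M0 aM]]]] := ell_flat_weight s0 Ha.
pose w : mi d -> R := sepmi (fun _ => weight q (/ sigma)).
have w1_ge0 m : 0 <= weight q (/ sigma) m by apply/Rlt_le/weight_gt0.
have w0 n : 0 <= w n by apply: sepmi_ge0.
have w_add k n : w (madd k n) <= w k * w n.
  rewrite /w /sepmi -big_split; apply: Rprod_le => j; split=> //.
  exact: weight_add.
pose W := \big[Rmult/1]_(j < d) Series (weight q (/ sigma)).
have HW : is_lim_seq (rbox w) W.
  apply: (rbox_sepmi_lim (F := fun _ => weight q (/ sigma))) => j.
  apply: ex_series_ext (ex_series_weight 1 q0 is0) => m.
  exact: Rmult_1_l.
pose ak n k := Cmult (a (madd k n)) (RtoC (mbinom_half k)).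
(* The binomial lies between 0 and 1, and [weight_add] splits the weight at k + n. *)
have ak_le n k : Cmod (ak n k) <= M * w n * w k.
  rewrite Cmod_mult Cmod_R Rabs_pos_eq; last by case: (mbinom_half_bounds k).
  have [b0 b1] := mbinom_half_bounds k.
  apply: (Rle_trans _ (Cmod (a (madd k n)) * 1)).
    by apply: Rmult_le_compat_l b1; apply: Cmod_ge_0.
  rewrite Rmult_1_r; apply: Rle_trans (aM _) _.
  rewrite Rmult_assoc; apply: Rmult_le_compat_l => //.
  by rewrite Rmult_comm; apply: w_add.
have lim_scal c (u : mi d -> R) U : is_lim_seq (rbox u) (Rbar.Finite U) ->
    is_lim_seq (rbox (fun n => c * u n)) (Rbar.Finite (c * U)).
  move=> HU; apply: (is_lim_seq_ext (fun N => c * rbox u N)) => [N|].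
    by rewrite /rbox big_distrr.
  exact: (is_lim_seq_scal_l _ c _ HU).
pose S n := msum (ak n).
have HS n := msum_dominated (ak_le n) (lim_scal (M * w n) w W HW).
exists S; split; first by move=> n; case: (HS n).
move=> b2.
have S_le n : Cmod (S n) <= M * w n * W := Cmod_msum_le (ak_le n) (lim_scal _ _ _ HW).
have main x : has_msum (fun n => Cmult (b2 n) (RtoC (hfun (mdouble n) x))) (f (vsq x)).
  pose A j := 1 + 2 * Rabs (x j).
  have A0 j : 0 < A j by have := Rabs_pos (x j); rewrite /A; lra.
  (* The growth rate A_j^2 from [ehermite_growth] goes into the base of the weight, which stays
     summable. *)
  pose u1 j m := A j * weight (A j ^ 2 * q) (/ sigma) m.
  have u10 j m : 0 <= u1 j m.
    apply: Rmult_le_pos; first exact/Rlt_le.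
    by apply/Rlt_le/weight_gt0/Rmult_lt_0_compat => //; apply: pow_lt.
  pose u n := M * sepmi u1 n.
  have u0 n : 0 <= u n by apply: Rmult_le_pos => //; apply: sepmi_ge0.
  have [U HU] : exists U : R, is_lim_seq (rbox u) U.
    eexists; apply: lim_scal; apply: rbox_sepmi_lim => j; apply: ex_series_weight => //.
    by apply: Rmult_lt_0_compat => //; apply: pow_lt.
  have Pu n : M * w n * Rabs (ehfun x n) <= u n.
    rewrite Rmult_assoc; apply: Rmult_le_compat_l => //.
    have := Rmult_le_compat_l _ _ _ (w0 n) (ehfun_bound x n).
    rewrite sepmi_mul; congr (_ <= _); apply: eq_bigr => j _.
    by rewrite /u1 /weight Rpow_mult_distr /A; ring.
  pose g i k := Cmult (RtoC (ehfun x i)) (ak i k).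
  pose SP i := Cmult (RtoC (ehfun x i)) (S i).
  have E : (fun n => Cmult (b2 n) (RtoC (hfun (mdouble n) x))) = SP.
    apply: functional_extensionality => n.
    by rewrite /SP -bcoef_hfun RtoC_mult /b2; ring.
  have W0 : 0 <= W := rbox_lim_ge0 w0 HW.
  have SP_le i : Cmod (SP i) <= W * u i.
    rewrite Cmod_mult Cmod_R.
    have := Rmult_le_compat_l _ _ _ (Rabs_pos (ehfun x i)) (S_le i).
    have := Rmult_le_compat_l _ _ _ W0 (Pu i).
    lra.
  have HSP := msum_dominated SP_le (lim_scal W u U HU).
  (* The majorant already gives absolute summability; it remains to identify the limit with the
     value of the Laguerre series. *)
  rewrite E; split; first by case: HSP => -[].
  have x2 : nonneg_pt (vsq x) by move=> j; apply: pow2_ge_0.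
  have [_ /filterlim_Cmod Lf] := Hf _ x2.
  have gu i k : Cmod (g i k) <= u i * w k.
    rewrite Cmod_mult Cmod_R.
    have := Rmult_le_compat_l _ _ _ (Rabs_pos (ehfun x i)) (ak_le i k).
    have := Rmult_le_compat_r _ _ _ (w0 k) (Pu i).
    lra.
  have SPg i N : Cmod (SP i - boxsum (g i) N) <= u i * (W - rbox w N).
    have -> : boxsum (g i) N = Cmult (RtoC (ehfun x i)) (boxsum (ak i) N).
      by rewrite /boxsum big_distrr.
    have -> : (SP i - RtoC (ehfun x i) * boxsum (ak i) N
               = RtoC (ehfun x i) * (S i - boxsum (ak i) N))%C by rewrite /SP; ring.
    rewrite Cmod_mult Cmod_R; have [_ /(_ N) HSi] := HS i.
    have Er : rbox (fun k => M * w i * w k) N = M * w i * rbox w N.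
      by rewrite /rbox big_distrr.
    rewrite Er in HSi.
    have := Rmult_le_compat_l _ _ _ (Rabs_pos (ehfun x i)) HSi.
    have D0 : 0 <= W - rbox w N by have := rbox_le_lim N w0 HW; lra.
    have := Rmult_le_compat_r _ _ _ D0 (Pu i).
    rewrite -/(S i); lra.
  have LT := msum_triangle u0 w0 gu HU HW SPg.
  apply/filterlim_Cmod.
  have := is_lim_seq_plus' _ _ _ _ LT Lf; rewrite Rplus_0_r.
  apply: is_lim_seq_le_le (is_lim_seq_const 0) => N; split; first exact: Cmod_ge_0.
  (* Regrouped by n = i + k, the triangle is the partial sum of the Laguerre series at [vsq x], as
     [lfun_vsq] shows. *)
  rewrite -(box_triangle _ _ g).
  set T := (T in _ <= Cmod (_ - T) + _).
  have -> : boxsum (fun n => Cmult (a n) (RtoC (lfun n (vsq x)))) N = T.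
    apply: eq_bigr => n _; rewrite lfun_vsq RtoC_sum big_distrr.
    apply: eq_bigr => i /forallP ilen; rewrite /g /ak RtoC_mult.
    have -> : madd (fun j => n j - i j)%N (fun j => i j : nat) = (fun j => n j : nat).
      by apply: functional_extensionality => j; rewrite /madd subnK.
    by rewrite /=; ring.
  have -> : (boxsum SP N - f (vsq x) = (boxsum SP N - T) + (T - f (vsq x)))%C by ring.
  exact: Cmod_triangle.
have flat : ell_flat sigma (even_ext b2).
  (* The radius from [weight_double] with s = 1 / sigma; its exponent s / 2 is the 1 / (2 sigma)
     required here. *)
  pose h := sqrt (/ (q * Rpower 2 (/ sigma))).
  pose B := \big[Rmult/1]_(j < d) Rpower PI (/ 4).
  have W0 : 0 <= W := rbox_lim_ge0 w0 HW.
  have B0 : 0 <= B by apply: Rprod_ge0 => j; apply/Rlt_le/exp_pos.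
  have K0 : 0 <= B * (M * W) by apply: Rmult_le_pos B0 (Rmult_le_pos _ _ M0 W0).
  exists h; split.
    apply/sqrt_lt_R0/Rinv_0_lt_compat/Rmult_lt_0_compat => //; exact: exp_pos.
  exists (B * (M * W)) => m.
  (* A multi-index with an odd coordinate has coefficient 0; any other one is [mdouble n]. *)
  have [/forallP ev|/negbTE nev] := boolP [forall j, ~~ odd (m j)]; last first.
    by rewrite /even_ext nev Cmod_0 !Rmult_0_l.
  pose n : mi d := fun j => (m j)./2.
  have -> : m = mdouble n.
    by apply: functional_extensionality => j; rewrite /mdouble /n mul2n halfK (negbTE (ev j)) subn0.
  rewrite even_ext_double Rmult_assoc pow_mabs Rpower_mfact sepmi_mul.
  set Z := sepmi _ _.
  have Z0 : 0 <= Z.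
    apply: sepmi_ge0 => j k; apply: Rmult_le_pos; last exact/Rlt_le/exp_pos.
    exact/pow_le/sqrt_pos.
  have wZ : w n * Z <= 1.
    rewrite /w /Z /sepmi -big_split.
    apply: (Rle_trans _ (\big[Rmult/1]_(j < d) 1)); last by rewrite big1 //; apply: Rle_refl.
    apply: Rprod_le => j; split.
      apply: Rmult_le_pos => //; apply: Rmult_le_pos; last exact/Rlt_le/exp_pos.
      exact/pow_le/sqrt_pos.
    have -> : / (2 * sigma) = / sigma / 2 by field; lra.
    exact: weight_double.
  have bB : Rabs (bcoef n) <= B.
    rewrite bcoefE /sepmi (big_morph Rabs Rabs_mult Rabs_R1); apply: Rprod_le => j.
    by split; [apply: Rabs_pos | apply: bcoef1_bound].
  have b2_le : Cmod (b2 n) <= B * (M * w n * W).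
    rewrite /b2 Cmod_mult Cmod_R.
    by apply: Rmult_le_compat; [apply: Rabs_pos | apply: Cmod_ge_0 | | apply: S_le].
  apply: Rle_trans (Rmult_le_compat_r _ _ _ Z0 b2_le) _.
  have := Rmult_le_compat_l _ _ _ K0 wZ; lra.
split=> //; split=> //; split; last first.
  (* A sign change is invisible after squaring. *)
  move=> j x; congr f; apply: functional_extensionality => i.
  by rewrite /vsq /flip; case: ifP => _ //; ring.
exists (even_ext b2); split=> // x.
by apply: (has_msum_even_ext (phi := fun m => hfun m x)).
Qed.
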